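(* Let $(\mathfrak{D},\preceq,\bot,\top)$ be a system model and let $R\subseteq\mathfrak{D}$ be a nontrivial prohibition. Then for every test setup $\mathbf{T}=(T,\alpha)$ for this system model, $R$ is not $\mathbf{T}$-verifiable.
   Context: A system model is a tuple $(\mathfrak{D},\preceq,\bot,\top)$ where $\mathfrak{D}$ is a nonempty set (of systems), $\preceq$ is a partial order on $\mathfrak{D}$ (refinement), $\bot$ is the least element and $\top$ the greatest element. A requirement is a subset $R\subseteq\mathfrak{D}$; it is trivial if $R=\emptyset$ or $R=\mathfrak{D}$, and nontrivial otherwise. A requirement $R$ is a prohibition if it is refinement-closed: for all $S,S'\in\mathfrak{D}$, $S\in R$ and $S'\preceq S$ imply $S'\in R$. A test setup is a pair $\mathbf{T}=(T,\alpha)$ where $T$ is a set (of observations) and $\alpha:\mathfrak{D}\to 2^T$ is order-preserving: $S\preceq S'$ implies $\alpha(S)\subseteq\alpha(S')$. For $t\in T$, $\hat\alpha(t)=\{S\in\mathfrak{D}\mid t\in\alpha(S)\}$. A requirement $R$ is $\mathbf{T}$-verifiable if for every $S\in\mathfrak{D}$ with $S\in R$ there exists $t\in\alpha(S)$ with $\hat\alpha(t)\subseteq R$. *)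

(* Defs.v *)
From mathcomp Require Import all_boot all_order.
From mathcomp Require Import boolp classical_sets.

Set Implicit Arguments.
Unset Strict Implicit.
Unset Printing Implicit Defensive.

Import Order.TTheory.

Local Open Scope order_scope.
Local Open Scope classical_set_scope.

(* A system model is a [tbPOrderType]:
   a partially ordered type (refinement is [<=]) with a least element [\bot] and
   a greatest element [\top], hence nonempty; no lattice or totality is assumed.
   The choice structure and the boolean order it carries are no restriction
   under the axioms of [boolp], which provide both for any type and relation. *)

Definition requirement {d : Order.disp_t} (D : tbPOrderType d) := set D.

Definition trivial_req {d : Order.disp_t} {D : tbPOrderType d}
    (R : requirement D) : Prop :=
  R = set0 \/ R = setT.

Definition nontrivial_req {d : Order.disp_t} {D : tbPOrderType d}
    (R : requirement D) : Prop :=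
  ~ trivial_req R.

Definition prohibition {d : Order.disp_t} {D : tbPOrderType d}
    (R : requirement D) : Prop :=
  forall S S' : D, R S -> S' <= S -> R S'.

Record test_setup {d : Order.disp_t} (D : tbPOrderType d) := TestSetup {
  obs : Type;
  alpha : D -> set obs;
  alpha_homo : forall S S' : D, S <= S' -> alpha S `<=` alpha S'
}.

Arguments obs {d D} T : rename.
Arguments alpha {d D} T S : rename.

Definition alpha_hat {d : Order.disp_t} {D : tbPOrderType d}
    (T : test_setup D) (t : obs T) : set D :=
  [set S | alpha T S t].

Definition verifiable {d : Order.disp_t} {D : tbPOrderType d}
    (T : test_setup D) (R : requirement D) : Prop :=
  forall S : D, R S -> exists t : obs T, alpha T S t /\ alpha_hat t `<=` R.

(* Main.v *)
(* A test observed on some system of R is also observed on the top system, since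
   alpha is monotone; so verifiability puts the top system in R, and refinement
   closure then puts every system in R. *)
Require Import Defs.
From mathcomp Require Import all_boot all_order.
From mathcomp Require Import boolp classical_sets.

Theorem lemma6 (d : Order.disp_t) (D : tbPOrderType d) (R : requirement D)
    (R_nontrivial : nontrivial_req R) (R_prohibition : prohibition R)
    (T : test_setup D) :
  ~ verifiable T R.
Proof.
move=> R_verifiable; apply: R_nontrivial.
(* Emptiness of [R] is decided classically; otherwise a member [S] is at hand, without which
   verifiability would yield no test. *)
have [->|/set0P [S RS]] := eqVneq R set0; first by left.
right; apply/seteqP; split=> // S' _.
have [t [St tR]] := R_verifiable S RS.
(* The top system lies above the arbitrary [S'], so its membership in [R] suffices. *)
apply: (R_prohibition Order.top); last exact: Order.TPreorderTheory.lex1.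
(* By unfolding, top lies in [alpha_hat t] when [t] is observed on top; monotonicity carries [St]
   there. *)
by apply: tR; apply: (alpha_homo (Order.TPreorderTheory.lex1 S)).
Qed.
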